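(* Let $(X,\mathscr{B},\mu,\{T^n\}_{n\in\mathbb{Z}})$ be a measure preserving system (a measure preserving $\mathbb{Z}$-action), and let $\omega(n)\searrow0$ be any sequence which decreases to $0$. For any $\lambda>0$ there are some $\alpha<\beta$, a bounded function $f$ on $X$ with $0\le f\le1$ and a $(1+\lambda)$-tempered Følner sequence $(F_n)$ in $\mathbb{Z}$ for which $$\mu(D_{(F_n),f,\alpha,\beta,N})>\omega(N)$$ for all but finitely many $N$.
   Context: A measure preserving $\mathbb{Z}$-action $(X,\mathscr{B},\mu,\{T^n\}_{n\in\mathbb{Z}})$ consists of a probability space $(X,\mathscr{B},\mu)$ and an invertible measure preserving map $T$ of it. Functions on $X$ are measurable. A Følner sequence in $\mathbb{Z}$ is a sequence $(F_n)$ of finite nonempty subsets of $\mathbb{Z}$ with $|(b+F_n)\triangle F_n|/|F_n|\to0$ for every $b\in\mathbb{Z}$. It is $c$-tempered if for all $n$, $\left|\bigcup_{i<n}(F_n-F_i)\right|\le c|F_n|$, where $F_n-F_i=\{a-b:a\in F_n,b\in F_i\}$. The ergodic averages along $(F_n)$ are $\mathsf{A}_nf(x)=\frac{1}{|F_n|}\sum_{k\in F_n}f(T^kx)$. A real sequence $(a_n)$ fluctuates $N$ times across a gap $(\alpha,\beta)$ if there are integers $n_1<n_2<\dots<n_{2N}$ such that $a_{n_i}\le\alpha$ for odd $i$ and $a_{n_i}\ge\beta$ for even $i$. $D_{(F_n),f,\alpha,\beta,N}$ is the set of $x\in X$ for which $(\mathsf{A}_nf(x))_{n\ge1}$ fluctuates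 across $(\alpha,\beta)$ at least $N$ times.
   Formalization: The claim fails if some power T^p, p≠0, acts trivially modulo null sets (e.g. T the identity, where averages never fluctuate); the formal theorem adds the hypothesis that no T^k with k≠0 acts as the identity modulo null sets, which excludes exactly the failing systems. *)

(* Defs.v *)
From HB Require Import structures.
From mathcomp Require Import all_boot all_order all_algebra finmap.
From mathcomp Require Import all_classical all_reals all_analysis.

Set Implicit Arguments.
Unset Strict Implicit.
Unset Printing Implicit Defensive.
Import Order.TTheory GRing.Theory Num.Theory.
Import numFieldNormedType.Exports.
Local Open Scope classical_set_scope.
Local Open Scope ring_scope.

(* Sequences are indexed by nat, starting at 0; no notion below depends on
   whether the first index is 0 or 1. *)

Section Action.
Context {d : measure_display} {X : measurableType d} {R : realType}.

(* T is an invertible measure preserving map with inverse Tinv. *)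
Record invertible_measure_preserving (mu : probability X R) (T Tinv : X -> X)
    : Prop := InvertibleMeasurePreserving {
  imp_measurable : measurable_fun setT T;
  imp_measurable_inv : measurable_fun setT Tinv;
  imp_cancel : cancel T Tinv;
  imp_cancel_inv : cancel Tinv T;
  imp_preserving :
    forall A : set X, measurable A -> mu (T @^-1` A) = mu A }.

(* The power T^k, k in Z. *)
Definition zpow (T Tinv : X -> X) (k : int) : X -> X :=
  match k with
  | Posz n => iter n T
  | Negz n => iter n.+1 Tinv
  end.

(* k in Z acts as the identity on the measure algebra of mu. *)
Definition acts_trivially (mu : probability X R) (T Tinv : X -> X) (k : int) :=
  forall A : set X, measurable A -> mu ((zpow T Tinv k @^-1` A) `+` A) = 0%E.

(* The action of Z does not factor, modulo null sets, through a finite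
   quotient Z/pZ.  This is weaker than freeness or aperiodicity.  If instead
   T^p acts trivially for some p > 0, then along every Foelner sequence the
   averages of a bounded f converge uniformly on a conull set, so there is a
   bound on the number of their fluctuations across any fixed gap. *)
Definition effective_action (mu : probability X R) (T Tinv : X -> X) :=
  forall k : int, k != 0 -> ~ acts_trivially mu T Tinv k.

Definition ergodic_avg (T Tinv : X -> X) (F : nat -> {fset int}) (f : X -> R)
    (n : nat) (x : X) : R :=
  (#|` F n|%:R)^-1 * \sum_(k <- F n) f (zpow T Tinv k x).

End Action.

Definition translate (b : int) (A : {fset int}) : {fset int} :=
  [fset (b + a)%R | a in A]%fset.

Definition sub_fset (A B : {fset int}) : {fset int} :=
  [fset (a - b)%R | a in A, b in B]%fset.

Definition symdiff (A B : {fset int}) : {fset int} :=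
  ((A `\` B) `|` (B `\` A))%fset.

Definition folner (R : realType) (F : nat -> {fset int}) : Prop :=
  (forall n, F n != fset0) /\
  (forall b : int,
    (#|` symdiff (translate b (F n)) (F n)|%:R / #|` F n|%:R : R)
      @[n --> \oo] --> (0 : R)).

Definition tempered (R : realType) (c : R) (F : nat -> {fset int}) : Prop :=
  forall n : nat,
    (#|` (\bigcup_(i <- iota 0 n) sub_fset (F n) (F i))%fset|%:R : R)
      <= c * #|` F n|%:R.

(* The indices n_1 < ... < n_(2N) are s 1, ..., s (2N); other values of s are
   irrelevant. *)
Definition fluctuates (R : realType) (a : nat -> R) (alpha beta : R) (N : nat)
    : Prop :=
  exists s : nat -> nat,
    (forall i j : nat, (1 <= i)%N -> (i < j)%N -> (j <= 2 * N)%N ->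
       (s i < s j)%N) /\
    (forall i : nat, (1 <= i)%N -> (i <= 2 * N)%N ->
       if odd i then a (s i) <= alpha else beta <= a (s i)).

Definition fluct_set {d : measure_display} {X : measurableType d}
    {R : realType} (T Tinv : X -> X) (F : nat -> {fset int}) (f : X -> R)
    (alpha beta : R) (N : nat) : set X :=
  [set x | fluctuates (fun n => ergodic_avg T Tinv F f n x) alpha beta N].

(* Main.v *)
(** Fix an integer [kappa >= 2 / lambda]. A Foelner set [F_n] that consists of an
    interval of length [kappa B q], with [B] large compared with the previous
    sets, followed by an arbitrary subset of the next [B q] integers, is
    (1+lambda)-tempered. If that subset is a union of residue classes modulo
    [q], and [q] tends to infinity with [n], the sequence is Foelner. Take half
    of the residues, alternately [0, q/2) and [q/2, 2(q/2)): if along the orbit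
    of [x] the function [f] is the indicator of the times with residue below
    [q/2], then the averages at [x] alternate between at most [1/2] and at least
    [1/2 + 1/(16 kappa)], for as many [n] as one wants with the same [q].

    It remains to produce [f] in stages [j], with moduli [q_j]. The point is that
    the measure [eps_j] of the set of good [x] at stage [j] can be bounded below
    before the number [N_j] of fluctuations, hence the time [L_j], is chosen:
    [N_j] is then picked with [omega(N_j) < eps_(j+1) / 2]. On the aperiodic part
    of [T], if it is not null, one uses a small proportion of a Rokhlin tower
    that is very high compared with [L_j]. Otherwise [T] is periodic almost
    everywhere, with unbounded periods since the action is effective, and one
    takes for [q_j] a large period that occurs with positive probability. Later
    stages override earlier ones, on sets so small that half of the good
    points of each stage survive. *)

Require Import Defs.
From mathcomp Require Import all_boot all_order all_algebra finmap.
From mathcomp Require Import all_classical all_reals all_analysis.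
From mathcomp Require Import measurable_realfun lra zify ring.
Import Order.TTheory GRing.Theory Num.Theory.
Import numFieldNormedType.Exports.
Local Open Scope classical_set_scope.
Local Open Scope ring_scope.

(** * Real-valued probabilities *)

Definition pr {d : measure_display} {X : measurableType d} {R : realType}
  (mu : probability X R) (A : set X) : R := fine (mu A).

Section ProbabilityReal.
Context {d : measure_display} {X : measurableType d} {R : realType}.
Context {mu : probability X R}.

Local Notation pr := (pr mu).

Lemma prE {A} : measurable A -> mu A = (pr A)%:E.
Proof. by move=> mA; rewrite /pr fineK// fin_num_measure. Qed.

Lemma pr_ge0 A : 0 <= pr A.
Proof. by rewrite /pr fine_ge0. Qed.

Lemma prT : pr setT = 1.
Proof. by rewrite /pr probability_setT. Qed.

Lemma pr0 : pr set0 = 0.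
Proof. by rewrite /pr measure0. Qed.

Lemma le_pr {A B} : measurable A -> measurable B -> A `<=` B -> pr A <= pr B.
Proof.
by move=> mA mB AB; rewrite -lee_fin -!prE//; apply: le_measure; rewrite ?inE.
Qed.

Lemma pr_null_sub {A B} : measurable A -> measurable B -> A `<=` B -> pr B = 0 ->
  pr A = 0.
Proof.
by move=> mA mB AB B0; apply/eqP; rewrite eq_le pr_ge0 andbT -B0 le_pr.
Qed.

Lemma prU {A B} : measurable A -> measurable B -> A `&` B = set0 ->
  pr (A `|` B) = pr A + pr B.
Proof.
move=> mA mB AB; apply/EFin_inj; rewrite EFinD -!prE//; last exact: measurableU.
by rewrite measureU.
Qed.

Lemma prDI {A B} : measurable A -> measurable B ->
  pr A = pr (A `\` B) + pr (A `&` B).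
Proof.
move=> mA mB; rewrite -prU; [|exact: measurableD|exact: measurableI|].
- by rewrite setUC setUIDK.
- by rewrite setDE setIACA setICl setI0.
Qed.

Lemma le_prU {A B} : measurable A -> measurable B -> pr (A `|` B) <= pr A + pr B.
Proof.
move=> mA mB; rewrite -(setDUK (@subsetUl _ A B)) prU//.
- rewrite lerD2l le_pr//; first by apply: measurableD => //; exact: measurableU.
  by rewrite setDUl setDv set0U; exact: subDsetl.
- by apply: measurableD => //; exact: measurableU.
- by rewrite setDIK.
Qed.

Lemma le_prD {A B} : measurable A -> measurable B -> pr A <= pr (A `\` B) + pr B.
Proof.
move=> mA mB; rewrite (prDI mA mB) lerD2l le_pr//; first exact: measurableI.
Qed.

Lemma pr_bigcup_null {F : nat -> set X} : (forall n, measurable (F n)) ->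
  (forall n, pr (F n) = 0) -> pr (\bigcup_n F n) = 0.
Proof.
move=> mF F0; apply: EFin_inj; rewrite -prE; last exact: bigcupT_measurable.
apply/negligibleP; first exact: bigcupT_measurable.
apply: negligible_bigcup => n; apply/negligibleP; first exact: mF.
by transitivity (pr (F n))%:E; [exact: prE|rewrite F0].
Qed.

Lemma pr_bigcup_geometric {F : nat -> set X} {e : R} :
  (forall n, measurable (F n)) -> (forall n, pr (F n) <= e / (2 ^ n.+1)%:R) ->
  pr (\bigcup_n F n) <= e.
Proof.
move=> mF Fe; have e0 : 0 <= e.
  have := le_trans (pr_ge0 _) (Fe 0%N).
  by rewrite expn1 pmulr_lge0// invr_gt0.
rewrite -lee_fin -prE; last exact: bigcupT_measurable.
apply: le_trans (epsilon_trick0 xpredT e0).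
apply: le_trans (measure_sigma_subadditive mu mF _ _) _ => //.
  exact: bigcupT_measurable.
by apply: lee_nneseries => // n _; rewrite [leLHS](prE (mF n)) lee_fin.
Qed.

Lemma pr_bigcap_small {F : nat -> set X} {e : R} :
  (forall n, measurable (F n)) -> (forall n, F n.+1 `<=` F n) ->
  pr (\bigcap_n F n) = 0 -> 0 < e -> exists n, forall k, (n <= k)%N -> pr (F k) <= e.
Proof.
move=> mF dF F0 e0.
have mI : measurable (\bigcap_n F n) by exact: bigcapT_measurable.
have hF : {homo F : n m / (n <= m)%N >-> (m <= n)%O}.
  apply: homo_leq => [A|A B C BA CB|n]; first exact: lexx.
  - exact: le_trans CB BA.
  - by apply/subsetPset; exact: dF.
have Foo : (mu (F 0%N) < +oo)%E by rewrite (prE (mF 0%N)) ltry.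
have := nonincreasing_cvg_mu Foo mF mI hF.
rewrite [X in _ --> X](prE mI) F0 => /fine_cvgP[_ /cvgrPdist_le/(_ _ e0)[n _ hn]].
exists n => k nk; have := hn k nk.
by rewrite /= sub0r normrN ger0_norm// pr_ge0.
Qed.

Lemma measurable_bigcup_lt {F : nat -> set X} n : (forall i, measurable (F i)) ->
  measurable (\bigcup_(i < n) F i).
Proof. by move=> mF; exact: bigcup_measurable. Qed.

Lemma bigcup_ltS (F : nat -> set X) n :
  \bigcup_(i < n.+1) F i =
  \bigcup_(i < n) F i `|` F n.
Proof.
apply/seteqP; split => [x [i /= +] Fi|x [[i /= ni Fi]|Fn]].
- rewrite ltnS leq_eqVlt => /orP[/eqP <-|ni]; [by right|by left; exists i].
- by exists i => //=; rewrite ltnS ltnW.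
- by exists n => /=.
Qed.

Lemma pr_bigcup_lt_le {F : nat -> set X} {c : R} n : (forall i, measurable (F i)) ->
  (forall i, pr (F i) <= c) ->
  pr (\bigcup_(i < n) F i) <= n%:R * c.
Proof.
move=> mF Fc; elim: n => [|n IH].
  by rewrite mul0r (_ : \bigcup_(_ in _) _ = set0) ?pr0// -subset0 => x [].
rewrite bigcup_ltS (le_trans (le_prU _ _))//; first exact: measurable_bigcup_lt.
by rewrite -natr1 mulrDl mul1r lerD.
Qed.

Lemma pr_bigcup_lt_eq {F : nat -> set X} {c : R} n : (forall i, measurable (F i)) ->
  (forall i, pr (F i) = c) ->
  (forall i j, (i < j < n)%N -> F i `&` F j = set0) ->
  pr (\bigcup_(i < n) F i) = n%:R * c.
Proof.
move=> mF Fc; elim: n => [|n IH] dF.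
  by rewrite mul0r (_ : \bigcup_(_ in _) _ = set0) ?pr0// -subset0 => x [].
rewrite bigcup_ltS prU//; first by rewrite IH// -?natr1 ?Fc; [lra|move=> i j ?;
  apply: dF; lia].
- exact: measurable_bigcup_lt.
- rewrite -subset0 => x [[i /= ni Fi] Fn].
  have : (F i `&` F n) x by split.
  by rewrite dF// ni/=.
Qed.

(* Greedy exhaustion: the [n]-th step comes within [1/(n+1)] of the supremum of
   the measures of the members that contain the current set. *)
Lemma pr_exhaustion (Q : set (set X)) (D0 : set X) :
  (forall D, Q D -> measurable D) -> Q D0 ->
  (forall D : nat -> set X, (forall n, Q (D n)) -> (forall n, D n `<=` D n.+1) ->
    Q (\bigcup_n D n)) ->
  exists2 D, Q D & forall D', Q D' -> D `<=` D' -> pr D' <= pr D.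
Proof.
move=> mQ QD0 cQ.
have step (p : nat * set X) : exists D : set X, Q p.2 -> [/\ Q D, p.2 `<=` D &
    forall D', Q D' -> D `<=` D' -> pr D' <= pr D + p.1.+1%:R^-1].
  case: p => n D /=; have [QD|] := pselect (Q D); last by exists set0.
  pose S := [set pr D' | D' in [set D' | Q D' /\ D `<=` D']].
  have hS : has_sup S.
    split; first by exists (pr D); exists D => //; split.
    exists 1 => _ [D' [QD' _] <-]; rewrite -prT.
    exact: le_pr (mQ _ QD') measurableT (@subsetT _ _).
  have n0 : 0 < n.+1%:R^-1 :> R by rewrite invr_gt0.
  have [_ [D' [QD' DD'] <-] hD'] := sup_adherent n0 hS.
  exists D' => _; split => // D2 QD2 D'2; rewrite -lerBlDr.
  apply: le_trans (ltW hD'); rewrite lerB//; apply: ub_le_sup; first by case: hS.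
  by exists D2 => //; split => //; exact: subset_trans D'2.
have [g gP] := choice step.
pose D := fix D n := if n is m.+1 then g (m, D m) else D0.
have QD n : Q (D n).
  by elim: n => //= n IH; have [] := gP (n, D n) IH.
have DS n : D n `<=` D n.+1 by have [] := gP (n, D n) (QD n).
exists (\bigcup_n D n); first exact: cQ.
move=> D' QD' DD'; apply/ler_addgt0Pr => e e0.
have [n ne] : exists n, n.+1%:R^-1 <= e.
  by have [n ne] := ltr_add_invr e0; exists n; rewrite add0r in ne; exact: ltW.
(* A competitor above the union lies above [D n], so step [n] limits its gain to [1/(n+1) <= e]. *)
have [_ _ h] := gP (n, D n) (QD n).
apply: le_trans (h D' QD' _) _; first by move=> x Dx; apply: DD'; exists n.+1.
apply: lerD => //; apply: le_pr; [exact: mQ (QD n.+1)|exact/mQ/cQ|].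
by move=> x Dx; exists n.+1.
Qed.

End ProbabilityReal.

(** * Periodic parts of the action *)

Section Dynamics.
Context {d : measure_display} {X : measurableType d} {R : realType}.
Context {mu : probability X R} {T Tinv : X -> X}.
Context (hT : invertible_measure_preserving mu T Tinv).

Local Notation pr := (pr mu).

Lemma measurable_preimage_iter k {A} : measurable A -> measurable (iter k T @^-1` A).
Proof.
move=> mA; elim: k => // k IH; rewrite (_ : _ @^-1` _ = T @^-1` (iter k T @^-1` A)).
  by rewrite -[_ @^-1` _]setTI; apply: (imp_measurable hT).
by apply/seteqP; split => x; rewrite /preimage /= -iterS iterSr.
Qed.

Lemma measurable_preimage_iterV k {A} :
  measurable A -> measurable (iter k Tinv @^-1` A).
Proof.
move=> mA; elim: k => // k IH;
  rewrite (_ : _ @^-1` _ = Tinv @^-1` (iter k Tinv @^-1` A)).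
  by rewrite -[_ @^-1` _]setTI; apply: (imp_measurable_inv hT).
by apply/seteqP; split => x; rewrite /preimage /= -iterS iterSr.
Qed.

Lemma pr_preimage_iter k {A} : measurable A -> pr (iter k T @^-1` A) = pr A.
Proof.
move=> mA; elim: k => // k IH; rewrite (_ : _ @^-1` _ = T @^-1` (iter k T @^-1` A)).
  by rewrite {1}/pr (imp_preserving hT)//; exact: measurable_preimage_iter.
by apply/seteqP; split => x; rewrite /preimage /= -iterS iterSr.
Qed.

Lemma iterK k : cancel (iter k T) (iter k Tinv).
Proof.
by elim: k => // k IH x; rewrite iterSr /= (imp_cancel hT) IH.
Qed.

Lemma iterVK k : cancel (iter k Tinv) (iter k T).
Proof.
by elim: k => // k IH x; rewrite iterSr /= (imp_cancel_inv hT) IH.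
Qed.

Lemma pr_preimage_iterV k {A} : measurable A -> pr (iter k Tinv @^-1` A) = pr A.
Proof.
move=> mA; rewrite -(pr_preimage_iter k); last exact: measurable_preimage_iterV.
by congr (pr _); apply/seteqP; split => x; rewrite /preimage /= iterK.
Qed.

(* [T^k] acts as the identity on the measure algebra of [E]. *)
Definition ktriv k (E : set X) :=
  forall C, measurable C -> C `<=` E -> pr (C `\` iter k T @^-1` C) = 0.

Lemma measurable_escape k {C} : measurable C -> measurable (C `\` iter k T @^-1` C).
Proof. by move=> mC; apply: measurableD => //; exact: measurable_preimage_iter. Qed.

(** A point of [C] that is outside [C] at time [(n+1)k] is either outside at time [k], or inside
    then and outside [n k] steps later; both events are null. *)
Lemma ktriv_mul n {k E} : ktriv k E -> ktriv (n * k) E.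
Proof.
move=> tE C mC CE; elim: n => [|n IH].
  by rewrite mul0n (_ : _ `\` _ = set0) ?pr0// setDv.
have mm : measurable (iter k T @^-1` (C `\` iter (n * k) T @^-1` C)).
  by apply/measurable_preimage_iter/measurable_escape.
apply: (pr_null_sub (B := (C `\` iter k T @^-1` C) `|`
    iter k T @^-1` (C `\` iter (n * k) T @^-1` C))).
- exact: measurable_escape.
- by apply: measurableU => //; exact: measurable_escape.
- move=> x [Cx]; rewrite /preimage /= mulSn addnC iterD => nC.
  by have [Ck|Ck] := pselect (C (iter k T x)); [right|left].
- apply/eqP; rewrite eq_le pr_ge0 andbT (le_trans (le_prU _ _))//.
    exact: measurable_escape.
  by rewrite pr_preimage_iter ?tE ?IH ?addr0//; exact: measurable_escape.
Qed.

Lemma ktriv_bigcup {k} {E : nat -> set X} : (forall n, measurable (E n)) ->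
  (forall n, ktriv k (E n)) -> ktriv k (\bigcup_n E n).
Proof.
move=> mE tE C mC CE.
have mCE n : measurable (C `&` E n) by exact: measurableI.
apply: (pr_null_sub
  (B := \bigcup_n ((C `&` E n) `\` iter k T @^-1` (C `&` E n)))).
- exact: measurable_escape.
- by apply: bigcupT_measurable => n; exact: measurable_escape.
- by move=> x [Cx nC]; have [n _ Ex] := CE x Cx; exists n => //; split => // -[].
- apply: pr_bigcup_null => n; first exact: measurable_escape.
  by apply: tE => // x [].
Qed.

Lemma ktrivU {k E F} : measurable E -> measurable F -> ktriv k E -> ktriv k F ->
  ktriv k (E `|` F).
Proof.
move=> mE mF tE tF; rewrite -bigcup2E; apply: ktriv_bigcup.
  by move=> [|[|n]]//=; exact: measurable0.
by move=> [|[|n]]//= C _ C0; rewrite (_ : _ `\` _ = set0) ?pr0// -subset0 => x [/C0].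
Qed.

Lemma ktriv_preimage {k E} {S S' : X -> X} :
  (forall A, measurable A -> measurable (S' @^-1` A) /\ pr (S' @^-1` A) = pr A) ->
  cancel S' S -> (forall x, S' (iter k T x) = iter k T (S' x)) ->
  ktriv k E -> ktriv k (S @^-1` E).
Proof.
move=> hS' SK cS tE C mC CE.
have [mC' _] := hS' _ mC; have [_ <-] := hS' _ (measurable_escape k mC).
rewrite (_ : _ @^-1` _ = (S' @^-1` C) `\` iter k T @^-1` (S' @^-1` C)).
  by apply: tE => // x /= /CE /=; rewrite SK.
by apply/seteqP; split => x; rewrite /preimage /= cS.
Qed.

(** Exhaustion yields a [ktriv] set of largest measure. Its saturation under forward and backward
    orbits is still [ktriv], and it is invariant at every point, not just almost everywhere. *)
Lemma exists_max_ktriv k : exists P, [/\ measurable P, (forall x, P (T x) <-> P x),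
  ktriv k P & forall E, measurable E -> ktriv k E -> pr (E `\` P) = 0].
Proof.
have [||D mtD|P0 [mP0 tP0] maxP0] := @pr_exhaustion _ _ _ mu
    [set P | measurable P /\ ktriv k P] set0.
- by move=> D [].
- by split => // C _ C0; rewrite (_ : _ `\` _ = set0) ?pr0// -subset0 => x [/C0].
- move=> _; split; first by apply: bigcupT_measurable => n; case: (mtD n).
  by apply: ktriv_bigcup => n; case: (mtD n).
pose P1 := \bigcup_n (iter n T @^-1` P0);
  pose P2 := \bigcup_n (iter n Tinv @^-1` P0).
have mP1 : measurable P1.
  by apply: bigcupT_measurable => n; exact: measurable_preimage_iter.
have mP2 : measurable P2.
  by apply: bigcupT_measurable => n; exact: measurable_preimage_iterV.
exists (P1 `|` P2); split.
- exact: measurableU.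
- move=> x; split => -[[n _ /= h]|[n _ /= h]].
  + by left; exists n.+1 => //=; rewrite -iterS iterSr.
  + case: n h => [h|n]; first by left; exists 1%N.
    by rewrite iterSr (imp_cancel hT) => h; right; exists n.
  + case: n h => [h|n]; last by rewrite iterSr => h; left; exists n.
    by right; exists 1%N => //=; rewrite (imp_cancel hT).
  + by right; exists n.+1 => //; rewrite /= -iterS iterSr (imp_cancel hT).
- apply: ktrivU => //; apply: ktriv_bigcup => n.
  + exact: measurable_preimage_iter.
  + apply: (ktriv_preimage (S' := iter n Tinv)) tP0 => [A mA||x].
    * by rewrite pr_preimage_iterV//; split => //; exact: measurable_preimage_iterV.
    * exact: iterVK.
    * rewrite -{1}[x](iterVK n) -iterD addnC iterD.
      by rewrite -[iter n T (iter k T _)]/(_) iterK.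
  + exact: measurable_preimage_iterV.
  + apply: (ktriv_preimage (S' := iter n T)) tP0 => [A mA||x].
    * by rewrite pr_preimage_iter//; split => //; exact: measurable_preimage_iter.
    * exact: iterK.
    * by rewrite -!iterD addnC.
- move=> E mE tE; have mEP : measurable (E `\` P0) by exact: measurableD.
  apply: (pr_null_sub (B := E `\` P0)) => //.
  + by apply: measurableD => //; exact: measurableU.
  + by apply: setDS => x; left; exists 0%N.
  + have := maxP0 (P0 `|` E) (conj (measurableU _ _ mP0 mE) (ktrivU mP0 mE tP0 tE))
      (@subsetUl _ _ _).
    have -> : P0 `|` E = P0 `|` (E `\` P0) by rewrite setDE setUIr setUv setIT.
    rewrite prU//; last by rewrite setDIK.
    by have := pr_ge0 (mu := mu) (E `\` P0); lra.
Qed.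

(* [C `\` iter k T @^-1` C] is disjoint from its own preimage under [T^k]. *)
Lemma disjoint_returns {E} H : measurable E -> 0 < pr E ->
  (forall k E', (0 < k <= H)%N -> measurable E' -> E' `<=` E -> ktriv k E' ->
     pr E' = 0) ->
  exists D, [/\ measurable D, D `<=` E, 0 < pr D &
    forall k x, (0 < k <= H)%N -> D x -> ~ D (iter k T x)].
Proof.
move=> mE E0; elim: H => [|H IH] hE.
  by exists E; split => // k x; lia.
have [k E' kH|D [mD DE D0 hD]] := IH; first by apply: hE; lia.
have ntD : ~ ktriv H.+1 D.
  by move=> /(hE _ _ _ mD DE); rewrite ltnS leqnn => /(_ isT); move: D0; lra.
(* As [D] is not [ktriv] at [H+1], some [C] inside it has an escaping part of positive measure. That
   part replaces [D] and inherits the earlier disjointness. *)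
have [C [mC CD C0]] : exists C, [/\ measurable C, C `<=` D &
    pr (C `\` iter H.+1 T @^-1` C) <> 0].
  apply: contrapT => nC; apply: ntD => C mC CD; apply: contrapT => C0.
  by apply: nC; exists C.
exists (C `\` iter H.+1 T @^-1` C); split.
- exact: measurable_escape.
- by move=> x [/CD/DE].
- by rewrite lt_neqAle pr_ge0 andbT; apply/eqP/nesym.
- move=> k x /andP[k0]; rewrite leq_eqVlt => /orP[/eqP ->|kH] [Cx nC] [Ck _] //.
  by apply: (hD k x) (CD _ Cx) (CD _ Ck); rewrite k0.
Qed.

End Dynamics.

(** * Painting periodic patterns *)

Section Patterns.
Context {d : measure_display} {X : measurableType d} {R : realType}.
Context {mu : probability X R} {T Tinv : X -> X}.
Context (hT : invertible_measure_preserving mu T Tinv).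

Local Notation pr := (pr mu).
Local Notation ktriv := (@ktriv _ _ _ mu T).

(** A weak Rokhlin lemma. If the translates of a maximal such [D] inside [Y] missed a non-null part
    of [Y], [disjoint_returns] would give a further piece to adjoin. The factor 2 counts forward and
    backward translates. *)
Lemma exists_max_tower {Y} H : measurable Y ->
  (forall k E, (0 < k <= H)%N -> measurable E -> E `<=` Y -> ktriv k E ->
     pr E = 0) ->
  exists D, [/\ measurable D,
    forall k x, (0 < k <= H)%N -> D x -> ~ D (iter k T x) &
    pr Y <= H.+1%:R * pr D *+ 2].
Proof.
move=> mY hY.
pose Q := [set D : set X | [/\ measurable D, D `<=` Y &
  forall k x, (0 < k <= H)%N -> D x -> ~ D (iter k T x)]].
have [||D QD DS|D [mD DY hD] maxD] := @pr_exhaustion _ _ _ mu Q set0.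
- by move=> D [].
- by split => // x.
- split; first by apply: bigcupT_measurable => n; case: (QD n).
    by move=> x [n _ Dx]; have [_ + _] := QD n; apply.
  move=> k x kH [i _ Di] [j _ Dj].
  have mono m n : (m <= n)%N -> D m `<=` D n.
    move=> /subnK <-; elim: (n - m)%N => // l IH.
    exact: subset_trans IH (DS _).
  have [_ _ h] := QD (maxn i j).
  apply: (h k x kH); first exact: mono (leq_maxl _ _) _ Di.
  exact: mono (leq_maxr _ _) _ Dj.
exists D; split => //.
pose U1 := \bigcup_(i < H.+1) (iter i T @^-1` D).
pose U2 := \bigcup_(i < H.+1) (iter i Tinv @^-1` D).
have mU1 : measurable U1.
  by apply: measurable_bigcup_lt => i; exact: measurable_preimage_iter hT _ _ mD.
have mU2 : measurable U2.
  by apply: measurable_bigcup_lt => i; exact: measurable_preimage_iterV hT _ _ mD.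
have mU : measurable (U1 `|` U2) by exact: measurableU.
have pU1 : pr U1 <= H.+1%:R * pr D.
  apply: pr_bigcup_lt_le => i; first exact: measurable_preimage_iter hT _ _ mD.
  by rewrite (pr_preimage_iter hT).
have pU2 : pr U2 <= H.+1%:R * pr D.
  apply: pr_bigcup_lt_le => i; first exact: measurable_preimage_iterV hT _ _ mD.
  by rewrite (pr_preimage_iterV hT).
have mYU : measurable (Y `\` (U1 `|` U2)) by exact: measurableD.
suff YU : pr (Y `\` (U1 `|` U2)) = 0.
  apply: le_trans (le_prD mY mU) _; rewrite YU add0r mulr2n.
  by apply: le_trans (le_prU mU1 mU2) _; exact: lerD.
apply: contrapT => /eqP YU; have {}YU : 0 < pr (Y `\` (U1 `|` U2)).
  by rewrite lt_neqAle pr_ge0 eq_sym YU.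
have [k E kH mE EY|D' [mD' D'Y D'0 hD']] := disjoint_returns hT H mYU YU.
  by apply: hY => //; apply: subset_trans EY _; exact: subDsetl.
have DD' : D `&` D' = set0.
  rewrite -subset0 => x [Dx D'x]; have [_ h] := D'Y x D'x.
  by apply: h; left; exists 0%N.
have : pr (D `|` D') <= pr D.
  apply: maxD => //; split; first exact: measurableU.
    by move=> x [/DY//|/D'Y[]].
  (* A passage from [D] to [D'] is excluded by [U2], one from [D'] to [D] by [U1]. *)
  move=> k x kH [Dx|D'x] [Dk|D'k].
  - exact: hD kH Dx Dk.
  - have [_ h] := D'Y _ D'k; apply: h; right; exists k; first by case/andP: kH.
    by rewrite /= (iterK hT).
  - have [_ h] := D'Y _ D'x; apply: h; left; exists k => //=.
    by case/andP: kH.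
  - exact: hD' kH D'x D'k.
by rewrite prU//; move: D'0; lra.
Qed.

(* [S] is the region in which [A] prescribes the function: later regions
   override earlier ones, so what has to be small is the set of points that
   visit [S] up to time [L]. *)
Definition pattern (delta eps : R) (q L : nat) (S A G : set X) :=
  [/\ measurable S, measurable A, measurable G, A `<=` S &
  [/\ pr (\bigcup_(m < L.+1) iter m T @^-1` S) <= delta,
      eps <= pr G &
      forall x m, G x -> (m <= L)%N ->
        S (iter m T x) /\ (A (iter m T x) <-> (m %% q < q./2)%N)]].

(* On the aperiodic part the pattern is painted on the lowest [3 l] levels of a
   Rokhlin tower of height [c l]. The bound [eps] does not depend on [L]: the
   base of the tower has measure at least [pr Y / (2 c l)]. *)
Lemma aperiodic_pattern {Y} : measurable Y -> 0 < pr Y ->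
  (forall k E, (0 < k)%N -> measurable E -> E `<=` Y -> ktriv k E ->
     pr E = 0) ->
  forall delta q, 0 < delta -> (0 < q)%N ->
  exists2 eps, 0 < eps & forall L, exists S A G, pattern delta eps q L S A G.
Proof.
move=> mY Y0 hY delta q delta0 q0.
(* A visit to the region within time [L < l] starts in the lowest [5 l] levels: [delta c >= 5] makes
   these small, and [c > 5] lets them fit in the tower. *)
have [c [c5 cdelta]] : exists c, (5 < c)%N /\ 5 <= delta * c%:R.
  pose n := Num.bound (5 / delta).
  have hn : 5 / delta < n%:R.
    by apply: archi_boundP; rewrite ltW// divr_gt0.
  exists (n + 6)%N; split; first lia.
  by rewrite mulrC -ler_pdivrMr// natrD; move: hn; lra.
have cq0 : 0 < c%:R * q%:R :> R by rewrite mulr_gt0// ltr0n; lia.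
exists (pr Y / (c%:R * q%:R)); first by rewrite divr_gt0.
move=> L; pose l := (L.+1 * q)%N; have l0 : (0 < l)%N by rewrite muln_gt0.
have Ll : (L < l)%N by rewrite leq_pmulr.
have [k E /andP[k0 _]|D [mD hD YD]] := exists_max_tower (c * l).-1 mY.
  exact: hY.
have cl0 : (0 < c * l)%N by rewrite muln_gt0 l0; lia.
rewrite prednK// in YD.
pose lev i := iter i T @^-1` D.
have mlev i : measurable (lev i) by exact: measurable_preimage_iter hT _ _ mD.
have plev i : pr (lev i) = pr D by exact: pr_preimage_iter hT _ _ mD.
have dlev i j x : (i < c * l)%N -> (j < c * l)%N -> lev i x -> lev j x -> i = j.
  wlog ij : i j / (i <= j)%N => [wl|ic jc Di Dj].
    by have [/wl//|/ltnW/wl h ? ? ? ?] := leqP i j; apply/esym/h.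
  apply/eqP; rewrite eqn_leq ij leqNgt; apply/negP => lij.
  have kH : (0 < j - i <= (c * l).-1)%N by lia.
  by apply: (hD _ _ kH Di); rewrite -iterD subnK.
have dlev' i j : (i < j < c * l)%N -> lev i `&` lev j = set0.
  move=> ij; rewrite -subset0 => x [ix jx].
  by have := dlev i j x _ _ ix jx; lia.
have D1 : (c * l)%:R * pr D <= 1.
  rewrite -(pr_bigcup_lt_eq _ mlev plev dlev') -(prT (mu := mu)).
  by apply: le_pr => //; exact: measurable_bigcup_lt.
(* Level [i] is [T^-i D], so time lowers the level. [A] reads the phase from the distance [3 l - i]
   to the top of the region. The levels [l + t q] of [G] have phase 0, since [q] divides [l], and
   lie high enough to stay in the region up to time [L]. *)
exists (\bigcup_(i < (3 * l).+1) lev i).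
exists (\bigcup_(i < (3 * l).+1)
  (if ((3 * l - i) %% q < q./2)%N then lev i else set0)).
exists (\bigcup_(t < 2 * L.+1) lev (l + t * q)%N).
have lc : (5 * l < c * l)%N by rewrite ltn_pmul2r.
have tl t : (t < 2 * L.+1)%N -> (l + t * q < 3 * l)%N.
  by move=> tL; have : (t * q < 2 * L.+1 * q)%N;
    [rewrite ltn_pmul2r|rewrite -mulnA -/l; lia].
split.
- exact: measurable_bigcup_lt.
- by apply: measurable_bigcup_lt => i; case: ifP.
- exact: measurable_bigcup_lt.
- by move=> x [i /= i3]; case: ifP => // _ ix; exists i.
split.
- apply: (@le_trans _ _ ((5 * l)%:R * pr D)).
    rewrite -(pr_bigcup_lt_eq _ mlev plev); last first.
      by move=> i j ij; apply: dlev'; lia.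
    apply: le_pr; last 1 first.
    + move=> x [m /= mL [i /= il]]; rewrite /lev /preimage /= -iterD => Dx.
      by exists (i + m)%N => //=; lia.
    + apply: measurable_bigcup_lt => m; apply: (measurable_preimage_iter hT).
      exact: measurable_bigcup_lt.
    + exact: measurable_bigcup_lt.
  have := pr_ge0 (mu := mu) D; move: D1 cdelta.
  rewrite (natrM _ c l) (natrM _ 5 l).
  have : 0 <= delta by exact: ltW.
  have : 0 < l%:R :> R by rewrite ltr0n.
  have : 0 < c%:R :> R by rewrite ltr0n; lia.
  set cc := c%:R; set ll := l%:R; set D' := pr _; move=> c0 ll0 dd D1 cd D'0.
  apply: (@le_trans _ _ (delta * (cc * ll * D'))); last by rewrite ler_piMr.
  by rewrite !mulrA !(ler_wpM2r)// ltW.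
- rewrite (@pr_bigcup_lt_eq _ _ _ _ (fun t => lev (l + t * q)%N) (pr D))//;
  last first.
    move=> i j /andP[ij jL]; apply: dlev'; have := tl j jL.
    have : (i * q < j * q)%N by rewrite ltn_pmul2r.
    lia.
  (* [G] has [2(L+1)] levels, each of measure at least [pr Y / (2 c l)]; since [l = (L+1) q], [L]
     cancels. *)
  rewrite ler_pdivrMr//; apply: le_trans YD _.
  rewrite le_eqVlt; apply/orP; left; apply/eqP; rewrite /l !natrM; ring.
- move=> x m [t /= tL Dx] mL.
  have Dm : lev (l + t * q - m)%N (iter m T x).
    by rewrite /lev /preimage /= -iterD subnK//; lia.
  have tlt := tl t tL.
  have modm : ((3 * l - (l + t * q - m)) %% q = m %% q)%N.
    have -> : (3 * l - (l + t * q - m) = (2 * L.+1 - t) * q + m)%N.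
      rewrite mulnBl -mulnA -/l; lia.
    by rewrite modnMDl.
  split; first by exists (l + t * q - m)%N => //=; lia.
  split => [[i /= il]|mq].
    case: ifP => // hi Di.
    by rewrite -modm (dlev _ i _ _ _ Dm Di)//; lia.
  by exists (l + t * q - m)%N; [rewrite /=; lia|rewrite modm mq].
Qed.

End Patterns.

(** * Periodic patterns and the choice between the two cases *)

Section ExistsPattern.
Context {d : measure_display} {X : measurableType d} {R : realType}.
Context {mu : probability X R} {T Tinv : X -> X}.
Context (hT : invertible_measure_preserving mu T Tinv).

Local Notation pr := (pr mu).
Local Notation ktriv := (@ktriv _ _ _ mu T).
Local Notation pattern := (@pattern _ _ _ mu T).

(* If [T^q] is the identity on [E], the pattern repeats forever, and the
   invariant set [V] may serve as the region for every [L]. *)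
Lemma periodic_pattern {V E} {q delta} : measurable V -> (forall x, V (T x) <-> V
  x) ->
  pr V <= delta -> measurable E -> E `<=` V -> ktriv q E -> (0 < q)%N ->
  0 < pr E ->
  (forall k E', (0 < k < q)%N -> measurable E' -> E' `<=` E -> ktriv k E' ->
     pr E' = 0) ->
  exists2 eps, 0 < eps & forall L, exists S A G, pattern delta eps q L S A G.
Proof.
move=> mV iV Vdelta mE EV tE q0 E0 hE.
have [k E' kq|D [mD DE D0 hD]] := disjoint_returns hT q.-1 mE E0.
  by apply: hE; lia.
(* Only a null part of [D] is lost here, and the pattern becomes exactly periodic along each
   orbit. *)
pose D' := \bigcap_n (iter (n * q) T @^-1` D).
have mD' : measurable D'.
  by apply: bigcapT_measurable => n; exact: measurable_preimage_iter hT _ _ mD.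
have D'D : D' `<=` D by move=> x /(_ 0%N); apply.
have D'q n x : D' x -> D' (iter (n * q) T x).
  by move=> D'x m _; rewrite /preimage /= -iterD -mulnDl; exact: D'x.
have iterV m x : V x -> V (iter m T x) by move=> Vx; elim: m => //= m /iV.
have pD' : pr D <= pr D'.
  apply: (le_trans (le_prD mD mD')); rewrite gerDr le_eqVlt; apply/orP; left.
  apply/eqP; pose N n := D `\` iter (n * q) T @^-1` D.
  apply: (pr_null_sub (B := \bigcup_n N n)).
  - exact: measurableD.
  - by apply: bigcupT_measurable => n; exact: measurable_escape hT _ _ mD.
  - move=> x [Dx nD'x]; have : (~` D') x by [].
    by rewrite setC_bigcap => -[n _ nDx]; exists n.
  - apply: pr_bigcup_null => n; first exact: measurable_escape hT _ _ mD.
    exact: ktriv_mul hT _ _ _ tE _ mD DE.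
exists (pr D') => [|L]; first exact: lt_le_trans D0 pD'.
exists V, (\bigcup_(r < q./2) (iter r Tinv @^-1` D')), D'; split => //.
- by apply: measurable_bigcup_lt => r; exact: measurable_preimage_iterV hT _ _ mD'.
- move=> x [r _ /D'D/DE/EV/(iterV r)]; rewrite (iterVK hT); exact.
split => //.
  apply: le_trans Vdelta; apply: le_pr => //.
    apply: measurable_bigcup_lt => m; exact: measurable_preimage_iter hT _ _ mV.
  move=> x [m _]; rewrite /preimage /=; elim: m => //= m IH /iV; exact: IH.
move=> x m D'x _; split; first exact/iterV/EV/DE/D'D.
rewrite {1}(divn_eq m q) addnC iterD; set y := iter _ T x.
have D'y : D' y by exact: D'q.
set r := (m %% q)%N; have rq : (r < q)%N by rewrite ltn_pmod.
split => [[s /= sq D's]|rq2]; last by exists r; rewrite //= (iterK hT).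
(* If [T^r y = T^s z] with [z] in [D'] and [s < q/2 <= r], then [D] would meet itself after
   [r - s < q] steps. *)
rewrite ltnNge; apply/negP => qr.
have rs : (0 < r - s <= q.-1)%N by lia.
apply: (hD _ y rs (D'D _ D'y)).
rewrite -[iter _ T y](iterK hT s) -iterD subnKC; first exact: D'D.
by lia.
Qed.

(** [ktriv] controls the points that leave a set; applied to the complement it controls those that
    enter. Together they form the symmetric difference. *)
Lemma effective_not_ktriv (hZ : effective_action mu T Tinv) k :
  (0 < k)%N -> ~ ktriv k setT.
Proof.
move=> k0 tk; apply: (hZ k%:Z); first by rewrite eqz_nat -lt0n.
move=> A mA; have mkA := measurable_preimage_iter hT k mA.
rewrite /setY /zpow (prE (mu := mu)); last by apply: measurableU; exact: measurableD.
congr (_%:E); apply/eqP; rewrite eq_le pr_ge0 andbT.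
apply: (le_trans (le_prU _ _)); try exact: measurableD.
have := tk _ (measurableC mA) (@subsetT _ _).
rewrite setDE preimage_setC setCK setIC -setDE => ->.
by rewrite add0r (tk _ mA (@subsetT _ _)).
Qed.

(** [P k] is the largest part on which [T^k] is trivial, and [Y] is the aperiodic part. If [Y] is
    null, the sets [V H] without periods up to [H] decrease to a null set; in a small one of them,
    the least period [q] exceeds [H]. *)
Lemma exists_pattern (hZ : effective_action mu T Tinv) (delta : R) p0 : 0 < delta ->
  exists q eps, [/\ (p0 <= q)%N, 0 < eps &
    forall L, exists S A G, pattern delta eps q L S A G].
Proof.
move=> delta0.
have [P hP] := choice (exists_max_ktriv hT).
pose V H := \bigcap_k (if (0 < k <= H)%N then ~` P k else setT).
pose Y := \bigcap_k ~` P k.+1.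
have mP k : measurable (P k) by case: (hP k).
have mV H : measurable (V H).
  by apply: bigcapT_measurable => k; case: ifP => // _; exact: measurableC.
have mY : measurable Y by apply: bigcapT_measurable => k; exact: measurableC.
have max_null k E F : measurable E -> E `<=` F -> (forall x, F x -> ~ P k x) ->
  ktriv k E ->
    pr E = 0.
  move=> mE EF FP tE; have [_ _ _ /(_ _ mE tE)] := hP k.
  rewrite setDidl// -subset0 => x [/EF/FP]; exact.
have [Y0|/negP] := boolP (0 < pr Y).
  have [eps eps0 h] : exists2 eps, 0 < eps &
      forall L, exists S A G, pattern delta eps p0.+1 L S A G.
    apply: (aperiodic_pattern hT mY Y0) => // -[//|k] E _ mE EY.
    by apply: max_null mE EY _ => x /(_ k); exact.
  by exists p0.+1, eps; split.
rewrite lt_neqAle pr_ge0 andbT => /negP; rewrite negbK eq_sym => /eqP Y0.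
have VS H : V H.+1 `<=` V H.
  move=> x Vx k _; have := Vx k I; case: ifP => [_|+ _].
    by case: ifP.
  by case: ifP => // /andP[-> kH]; rewrite leqW.
have VY : \bigcap_H V H `<=` Y.
  by move=> x Vx k _; have := Vx k.+1 I k.+1 I; rewrite leqnn.
have pV0 : pr (\bigcap_H V H) = 0.
  by apply: pr_null_sub VY Y0 => //; exact: bigcapT_measurable.
have [n hn] := pr_bigcap_small mV VS pV0 delta0.
pose H := maxn n p0.
have Vdelta : pr (V H) <= delta by apply: hn; rewrite leq_maxl.
have iV x : V H (T x) <-> V H x.
  by split => Vx k _; have := Vx k I; case: ifP => // _; rewrite /setC /=;
    have [_ -> _ _] := hP k.
have VH0 : 0 < pr (V H).
  rewrite lt_neqAle pr_ge0 andbT eq_sym; apply/eqP => VH0.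
  (* If [V H] were null, [P 1], ..., [P H] would cover almost everything, and [T] to the power [H!]
     would act trivially. *)
  apply: (effective_not_ktriv hZ _ (fact_gt0 H)).
  pose U k := if (0 < k <= H)%N then P k else set0.
  have -> : setT = V H `|` \bigcup_k U k.
    apply/esym; rewrite -subTset => x _.
    have [[k kU]|nU] := pselect (exists k, U k x); [by right; exists k|left].
    move=> k _; case: ifP => // kH Pk; apply: nU; exists k.
    by rewrite /U kH.
  apply: (ktrivU hT) => //.
  - by apply: bigcupT_measurable => k; rewrite /U; case: ifP.
  - move=> C mC CV; apply: pr_null_sub VH0 => //; last by move=> x [/CV].
    exact: measurable_escape hT _ _ mC.
  - apply: (ktriv_bigcup hT) => k; rewrite /U; case: ifP => // kH.
      have /dvdnP[t ->] : (k %| H`!)%N by rewrite dvdn_fact.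
      by apply: (ktriv_mul hT); case: (hP k).
    by move=> C _ C0; rewrite (_ : _ `\` _ = set0) ?pr0// -subset0 => x [/C0].
have exq : exists k, (0 < k)%N && (0 < pr (V H `&` P k)).
  apply: contrapT => nk.
  have : pr (\bigcup_k (V H `&` P k.+1)) = 0.
    apply: pr_bigcup_null => k; first exact: measurableI.
    apply/eqP; rewrite eq_le pr_ge0 andbT leNgt; apply/negP => h.
    by apply: nk; exists k.+1.
  have := @le_prU _ _ _ mu (\bigcup_k (V H `&` P k.+1)) Y.
  have mU : measurable (\bigcup_k (V H `&` P k.+1)).
    by apply: bigcupT_measurable => k; exact: measurableI.
  have : pr (V H) <= pr ((\bigcup_k (V H `&` P k.+1)) `|` Y).
    apply: le_pr => //; first exact: measurableU.
    move=> x Vx; have [|nx] := pselect ((\bigcup_k (V H `&` P k.+1)) x); first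
      by left.
    by right => k _ Pk; apply: nx; exists k.
  by move=> h1 /(_ mU mY) h2 h3; move: h1 h2 h3 Y0 VH0; lra.
(* Minimality makes every part of [V H] with a period below [q] null, as [periodic_pattern]
   requires. *)
case: (ex_minnP exq) => q /andP[q0 Eq0] qmin.
have qH : (H < q)%N.
  rewrite ltnNge; apply/negP => qH; move: Eq0.
  rewrite (_ : _ `&` _ = set0) ?pr0 ?ltxx// -subset0 => x [/(_ q I)].
  by rewrite q0 qH.
have [eps eps0 h] : exists2 eps, 0 < eps &
    forall L, exists S A G, pattern delta eps q L S A G.
  apply: (@periodic_pattern (V H) (V H `&` P q)) => //.
  - exact: measurableI.
  - by move=> C mC CE; have [_ _ tq _] := hP q; apply: tq => // x /CE[].
  - move=> k E /andP[k0 kq] mE EV tE.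
    have Ek : pr (E `&` P k) = 0.
      apply/eqP; rewrite eq_le pr_ge0 andbT leNgt; apply/negP => h.
      have := qmin k; rewrite k0 (lt_le_trans h)//=; last first.
        apply: le_pr; [exact: measurableI|exact: measurableI|].
        by move=> x [/EV[]].
      by move=> /(_ isT); rewrite leqNgt kq.
    by rewrite (prDI mE (mP k)) Ek; have [_ _ _ ->] := hP k; rewrite ?addr0.
by exists q, eps; split => //; lia.
Qed.

End ExistsPattern.

(** * Tempered sequences of combs *)

Lemma mem_translate (b : int) A x : (x \in translate b A) = (x - b \in A).
Proof.
apply/imfsetP/idP => /= [[y Ay ->]|Ax]; first by rewrite addrC addKr.
by exists (x - b) => //; rewrite addrC subrK.
Qed.

Lemma card_translate (b : int) A : #|` translate b A| = #|` A|.
Proof. by rewrite card_imfset//; exact: addrI. Qed.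

Lemma translate_symdiff (b : int) A B :
  symdiff (translate b A) (translate b B) = translate b (symdiff A B).
Proof. by apply/fsetP => x; rewrite !(inE, mem_translate). Qed.

Lemma translateD (b c : int) A : translate (b + c) A = translate b (translate c A).
Proof. by apply/fsetP => x; rewrite !mem_translate opprD addrA. Qed.

Lemma translate0 A : translate 0 A = A.
Proof. by apply/fsetP => x; rewrite mem_translate subr0. Qed.

Lemma symdiffC A B : symdiff A B = symdiff B A.
Proof. by rewrite /symdiff fsetUC. Qed.

Lemma card_symdiff_triangle A B C :
  (#|` symdiff A C| <= #|` symdiff A B| + #|` symdiff B C|)%N.
Proof.
apply: leq_trans (leq_card_fsetU _ _); apply/fsubset_leq_card/fsubsetP => x.
by rewrite !inE; do 3 case: (x \in _).
Qed.

Lemma card_symdiff_eq A B : #|` A| = #|` B| ->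
  (#|` symdiff A B| <= #|` (A `\` B)%fset| * 2)%N.
Proof.
move=> AB; apply: leq_trans (leq_card_fsetU _ _) _.
by rewrite muln2 -addnn leq_add2l !cardfsD AB fsetIC.
Qed.

Lemma card_symdiff_translate_nat n A :
  (#|` symdiff (translate n%:Z A) A| <= n * #|` symdiff (translate 1 A) A|)%N.
Proof.
elim: n => [|n IH].
  by rewrite translate0 mul0n leqn0 cardfs_eq0 /symdiff fsetDv fsetU0.
apply: leq_trans (card_symdiff_triangle _ (translate n%:Z A) _) _.
rewrite mulSn leq_add// -addn1 PoszD translateD translate_symdiff.
by rewrite card_translate.
Qed.

(** A shift by [b] is [|b|] unit shifts of equal cost, so the Foelner condition reduces to the unit
    shift. *)
Lemma card_symdiff_translate (b : int) A :
  (#|` symdiff (translate b A) A| <= `|b| * #|` symdiff (translate 1 A) A|)%N.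
Proof.
have [b0|b0] := lerP 0 b.
  by rewrite -{1}(gez0_abs b0); exact: card_symdiff_translate_nat.
rewrite -{2}[A]translate0 -(addrN b) translateD translate_symdiff card_translate.
rewrite symdiffC -(ltz0_abs b0); exact: card_symdiff_translate_nat.
Qed.

(** * Finite sets of naturals and counting over periods *)

Definition natset (s : seq nat) : {fset int} := seq_fset tt (map Posz s).

Lemma natsetP s x : reflect (exists2 m, m \in s & x = m%:Z) (x \in natset s).
Proof. by rewrite seq_fsetE; exact: mapP. Qed.

Lemma mem_natset s (m : nat) : (m%:Z \in natset s) = (m \in s).
Proof. by rewrite seq_fsetE mem_map// => ? ? []. Qed.

Lemma perm_natset s : uniq s -> perm_eq (natset s) (map Posz s).
Proof.
move=> us; rewrite -[X in perm_eq _ X]undup_id ?seq_fset_perm//.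
by rewrite map_inj_uniq// => ? ? [].
Qed.

Lemma card_natset s : uniq s -> #|` natset s| = size s.
Proof. by move=> /perm_natset/perm_size ->; rewrite size_map. Qed.

Lemma card_natset_le s : (#|` natset s| <= size s)%N.
Proof. by rewrite size_seq_fset (leq_trans (size_undup _))// size_map. Qed.

Lemma count_periodic (p : pred nat) q a b : (forall m, p (m %% q)%N = p m) ->
  count p (iota (a * q) (b * q)) = (b * count p (iota 0 q))%N.
Proof.
move=> pq; elim: b => [|b IH]; first by rewrite !mul0n.
rewrite mulSnr iotaD count_cat IH mulSnr; congr addn.
rewrite -mulnDl -[X in iota X q]addn0 iotaDl count_map; apply: eq_count => i /=.
by rewrite -pq modnMDl pq.
Qed.

Lemma count_interval c h q : (c + h <= q)%N ->
  count (fun m => c <= m < c + h)%N (iota 0 q) = h.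
Proof.
move=> /subnKC <-; rewrite !iotaD !count_cat !add0n.
rewrite (eq_in_count (a2 := pred0)) ?count_pred0; last first.
  by move=> m; rewrite mem_iota /=; lia.
rewrite (eq_in_count (a2 := predT)) ?count_predT ?size_iota; last first.
  by move=> m; rewrite mem_iota /=; lia.
rewrite (eq_in_count (a2 := pred0)) ?count_pred0 ?addn0//.
by move=> m; rewrite mem_iota /=; lia.
Qed.

(* A long interval followed by a stretch, shorter by the factor [kappa], in
   which only the residues [c, c + q/2) modulo [q] are kept. *)
Definition comb (kappa q b c : nat) : seq nat :=
  [seq m <- iota 0 (kappa.+1 * b * q) |
    (m < kappa * b * q) || (c <= m %% q < c + q./2)]%N.

Lemma comb_uniq kappa q b c : uniq (comb kappa q b c).
Proof. exact: filter_uniq (iota_uniq _ _). Qed.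

Lemma mem_comb kappa q b c m : (m \in comb kappa q b c) =
  ((m < kappa.+1 * b * q) && ((m < kappa * b * q) || (c <= m %% q < c + q./2)))%N.
Proof. by rewrite mem_filter mem_iota add0n leq0n andbC. Qed.

Lemma count_comb (p : pred nat) kappa q b c : (forall m, p (m %% q)%N = p m) ->
  count p (comb kappa q b c) = (kappa * b * count p (iota 0 q) +
    b * count (fun m => p m && (c <= m %% q < c + q./2)%N) (iota 0 q))%N.
Proof.
move=> pq; rewrite count_filter (_ : kappa.+1 * b * q = kappa * b * q + b * q)%N;
  last first.
  by rewrite mulSn mulnDl addnC.
rewrite iotaD count_cat; congr addn.
  rewrite -(count_periodic p q 0 (kappa * b) pq) mul0n; apply: eq_in_count => m.
  by rewrite mem_iota /= add0n => ->; rewrite andbT.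
rewrite -(count_periodic _ q (kappa * b) b); last by move=> m; rewrite pq modn_mod.
apply: eq_in_count => m; rewrite mem_iota add0n => /andP[hm _] /=.
by rewrite [(m < _)%N]ltnNge hm.
Qed.

Lemma size_comb kappa q b c : (c + q./2 <= q)%N ->
  size (comb kappa q b c) = (kappa * b * q + b * q./2)%N.
Proof.
move=> cq; rewrite -count_predT count_comb// count_predT size_iota;
  congr (_ + b * _)%N.
rewrite -[RHS](count_interval c _ q cq); apply: eq_in_count => m;
  rewrite mem_iota => /andP[_ mq] /=.
by rewrite modn_small.
Qed.

(** The teeth contain no counted residue, so only the long interval contributes. *)
Lemma count_comb_low kappa q b :
  count (fun m => m %% q < q./2)%N (comb kappa q b q./2) = (kappa * b * q./2)%N.
Proof.
rewrite count_comb => [|m]; last by rewrite modn_mod.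
rewrite [X in (b * X)%N](eq_count (a2 := pred0)) ?count_pred0 ?muln0 ?addn0.
  congr muln; rewrite -[RHS](count_interval 0 _ q); last by lia.
  apply: eq_in_count => m; rewrite mem_iota => /andP[_ mq] /=.
  by rewrite modn_small.
by move=> m /=; lia.
Qed.

Lemma count_comb_high kappa q b :
  count (fun m => m %% q < q./2)%N (comb kappa q b 0) = (kappa.+1 * b * q./2)%N.
Proof.
have hq : count (fun m => m %% q < q./2)%N (iota 0 q) = q./2.
  rewrite -[RHS](count_interval 0 _ q); last by lia.
  apply: eq_in_count => m; rewrite mem_iota => /andP[_ mq] /=.
  by rewrite modn_small.
rewrite count_comb => [|m]; last by rewrite modn_mod.
rewrite (eq_count (a1 := fun m => _ && _) (a2 := fun m => m %% q < q./2)%N).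
  by rewrite hq mulSn mulnDl addnC.
by move=> m /=; rewrite andbb.
Qed.

(** A unit shift adds at most one point after the interval and one after each of the [b] teeth, and
    loses as many. The bound does not involve [q]. *)
Lemma card_comb_boundary kappa q b c : (c + q./2 <= q)%N -> (0 < q)%N ->
  (#|` symdiff (translate 1 (natset (comb kappa q b c))) (natset (comb kappa q b c))|
     <= b.+1 * 2)%N.
Proof.
move=> cq q0; apply: leq_trans (card_symdiff_eq _ _ (card_translate _ _)) _.
rewrite leq_mul2r /=.
pose ends := (kappa * b * q)%N :: [seq (t * q + (c + q./2))%N | t <- iota (kappa
  * b) b].
apply: (@leq_trans #|` natset ends|); last first.
  by apply: leq_trans (card_natset_le _) _; rewrite /= size_map size_iota.
apply/fsubset_leq_card/fsubsetP => x; rewrite inE mem_translate => /andP[nFx].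
move=> /natsetP[m mF] /eqP; rewrite subr_eq -PoszD addn1 => /eqP xm.
move: nFx; rewrite xm !mem_natset => nFm.
move: mF nFm; rewrite !mem_comb => /andP[mM hm] nFm.
rewrite inE; have [//|/eqP mk] := eqVneq m.+1 (kappa * b * q)%N.
have mkb : (kappa * b * q <= m)%N.
  rewrite leqNgt; apply/negP => hlt.
  have m1 : (m.+1 < kappa * b * q)%N by rewrite ltn_neqAle hlt andbT; apply/eqP.
  move: nFm; rewrite m1 /= andbT (leq_trans m1)//.
  by rewrite !leq_mul2r leqnSn !orbT.
move: hm; rewrite ltnNge mkb /= => /andP[cm mh].
apply/mapP; exists (m %/ q)%N.
  rewrite mem_iota leq_divRL// mkb /= ltn_divLR// addnC.
  by rewrite -mulSn.
(* Otherwise [m+1] would still lie in the same tooth. *)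
suff <- : ((m %% q).+1 = c + q./2)%N by rewrite addnS -divn_eq.
apply/eqP; rewrite eqn_leq mh leqNgt /=; apply/negP => mh'.
have mq1 : (m.+1 %% q = (m %% q).+1)%N.
  by rewrite {1}(divn_eq m q) -addnS modnMDl modn_small//; lia.
have mM' : (m.+1 < kappa.+1 * b * q)%N.
  rewrite [X in (X < _)%N](divn_eq m.+1 q) mq1.
  have : (m.+1 %/ q < kappa.+1 * b)%N.
    rewrite (_ : m.+1 %/ q = m %/ q)%N ?ltn_divLR//.
   
      by rewrite {1}(divn_eq m q) -addnS divnMDl// (@divn_small (m %% q).+1) ?addn0//; lia.
  move=> h; apply: (@leq_trans ((m.+1 %/ q).+1 * q)); last
    by rewrite leq_mul2r h orbT.
  by rewrite mulSn addnC ltn_add2r; lia.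
by move: nFm; rewrite mM' mq1 mh' /= (leqW cm) orbT.
Qed.

Section CombSequence.
Context {R : realType} (kappa : nat) (q b c : nat -> nat).
Context (kappa_gt0 : (0 < kappa)%N) (q_gt0 : forall n, (0 < q n)%N).
Context (b_gt0 : forall n, (0 < b n)%N).
Context (c_le : forall n, (c n + (q n)./2 <= q n)%N).

Let F n := natset (comb kappa (q n) (b n) (c n)).

Lemma comb_card n : #|` F n| = (kappa * b n * q n + b n * (q n)./2)%N.
Proof. by rewrite card_natset ?comb_uniq// size_comb. Qed.

Lemma comb_card_ge n : (kappa * b n * q n <= #|` F n|)%N.
Proof. by rewrite comb_card leq_addr. Qed.

Lemma comb_card_gt0 n : (0 < #|` F n|)%N.
Proof. by apply: leq_trans (comb_card_ge n);
  rewrite !muln_gt0 kappa_gt0 b_gt0 q_gt0. Qed.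

(** The boundary is at most [4 |t| b] against at least [b q] points: [b] cancels and [4 |t| / q]
    tends to 0. *)
Lemma comb_folner : (forall j, exists n0, forall n, (n0 <= n)%N -> (j <= q n)%N) ->
  folner R F.
Proof.
move=> qoo; split => [n|t]; first by rewrite -cardfs_gt0 comb_card_gt0.
apply/cvgrPdist_le => e e0.
have [n0 hn0] := qoo (Num.bound (4 * `|t|%:R / e)).
exists n0 => // n /= nn0; rewrite sub0r normrN ger0_norm ?divr_ge0//.
rewrite ler_pdivrMr ?ltr0n ?comb_card_gt0//.
have h1 : (#|` symdiff (translate t (F n)) (F n)| <= `|t| * (b n * 4))%N.
  apply: leq_trans (card_symdiff_translate _ _) _; rewrite leq_mul2l.
  apply/orP; right; apply: leq_trans (card_comb_boundary _ _ _ _ (c_le n) (q_gt0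
    n)) _.
  by have := b_gt0 n; lia.
have h2 : 4 * `|t|%:R <= e * (q n)%:R :> R.
  rewrite [e * _]mulrC -ler_pdivrMr//.
  have hq : (Num.bound (4 * `|t|%:R / e))%:R <= (q n)%:R :> R by rewrite ler_nat hn0.
  apply: le_trans hq; apply/ltW/archi_boundP.
  by rewrite divr_ge0 ?mulr_ge0// ltW.
apply: (@le_trans _ _ (`|t| * (b n * 4))%:R); first by rewrite ler_nat.
apply: (@le_trans _ _ (e * (b n * q n)%:R)).
  rewrite !natrM; have b0 : 0 <= (b n)%:R :> R by [].
  by move: (ler_wpM2l b0 h2); lra.
apply: ler_wpM2l; first exact: ltW.
rewrite ler_nat; apply: leq_trans (comb_card_ge n).
by rewrite -mulnA leq_pmull.
Qed.

(** Earlier sets lie in [[0, M]] and [F n] in [[0, (kappa+1) M)], so the differences fill at most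
    [(kappa+2) M] places, against at least [kappa M] points of [F n]; and [2 / kappa <= lambda]. *)
Lemma comb_tempered (lambda : R) : 2 <= lambda * kappa%:R ->
  (forall i n, (i < n)%N -> (kappa.+1 * b i * q i <= b n * q n)%N) ->
  tempered (1 + lambda) F.
Proof.
move=> lk grow n.
set M := (b n * q n)%N.
pose I := translate (- M%:Z) (natset (iota 0 (kappa.+2 * M))).
apply: (@le_trans _ _ (kappa.+2 * M)%:R).
  rewrite ler_nat; apply: (@leq_trans #|` I|); last first.
    by rewrite card_translate (leq_trans (card_natset_le _))// size_iota.
  apply/fsubset_leq_card/bigfcupsP => i; rewrite mem_iota => /andP[_ in_] _.
  apply/fsubsetP => x /imfset2P[/= y /natsetP[m mn ->] [z /natsetP[l li ->] ->]].
  rewrite mem_translate opprK.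
  move: mn li; rewrite !mem_comb => /andP[mn _] /andP[li _].
  have lM : (l <= M)%N by apply: ltnW; apply: leq_trans li (grow _ _ in_).
  have -> : m%:Z - l%:Z + M%:Z = (m + (M - l))%N%:Z by lia.
  rewrite mem_natset mem_iota /= add0n mulSn addnC.
  move: mn; rewrite -mulnA -/M; lia.
apply: (@le_trans _ _ ((1 + lambda) * (kappa * M)%:R)).
  have -> : (kappa.+2 * M)%:R = (kappa%:R + 2) * M%:R :> R
    by rewrite natrM -natr1 -natr1; ring.
  rewrite natrM mulrA ler_wpM2r//; lra.
rewrite ler_wpM2l//; last by rewrite ler_nat /M mulnA comb_card_ge.
have : 0 < kappa%:R :> R by rewrite ltr0n.
by move=> k0; rewrite addr_ge0// -(pmulr_lge0 _ k0); lra.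
Qed.

Lemma comb_avg {d : measure_display} {X : measurableType d} (T Tinv : X -> X)
    (f : X -> R) n x :
  (forall m, (m < kappa.+1 * b n * q n)%N ->
    f (iter m T x) = (m %% q n < (q n)./2)%N%:R) ->
  ergodic_avg T Tinv F f n x =
  (count (fun m => m %% q n < (q n)./2)%N (comb kappa (q n) (b n) (c n)))%:R /
  (kappa * b n * q n + b n * (q n)./2)%:R.
Proof.
move=> hf; rewrite /ergodic_avg comb_card mulrC; congr (_ / _).
rewrite (perm_big _ (perm_natset _ (comb_uniq _ _ _ _))) big_map /=.
rewrite -sum1_count natr_sum [RHS]big_mkcond big_seq [RHS]big_seq;
  apply: eq_bigr => m.
rewrite mem_comb => /andP[mM _]; rewrite hf//.
by case: ifP.
Qed.

End CombSequence.

(** * Proportion of low residues in the two kinds of comb *)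

Lemma low_ratio_le (R : realType) (kappa b q : nat) :
  (0 < kappa)%N -> (0 < b)%N -> (0 < q)%N ->
  (kappa * b * q./2)%:R / (kappa * b * q + b * q./2)%:R <= 2^-1 :> R.
Proof.
move=> k0 b0 q0; rewrite ler_pdivrMr; last
  by rewrite ltr0n addn_gt0 !muln_gt0 k0 b0 q0.
rewrite mulrC ler_pdivlMr// -natrM ler_nat.
have : (kappa * b * (q./2 * 2) <= kappa * b * q)%N by rewrite leq_mul2l;
  apply/orP; right; lia.
by rewrite mulnA; lia.
Qed.

(** For even [q] the ratio is [1/2 + 1/(4 kappa + 2)]; the weaker [1/(16 kappa)] absorbs the
    rounding of [q/2] for odd [q]. *)
Lemma high_ratio_ge (R : realType) (kappa b q : nat) :
  (0 < kappa)%N -> (0 < b)%N -> (4 * kappa + 2 <= q)%N ->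
  2^-1 + (16 * kappa%:R)^-1 <=
    (kappa.+1 * b * q./2)%:R / (kappa * b * q + b * q./2)%:R :> R.
Proof.
move=> k0 b0 q0; set h := q./2.
have hk : (2 * kappa <= h)%N by rewrite /h; lia.
have qh : (q <= 2 * h + 1)%N by rewrite /h; lia.
rewrite ler_pdivlMr; last by rewrite ltr0n addn_gt0 !muln_gt0 k0 b0; lia.
have kR : 1 <= kappa%:R :> R by rewrite ler1n.
have bR : 0 < b%:R :> R by rewrite ltr0n.
have {}hk : 2 * kappa%:R <= h%:R :> R by rewrite -natrM ler_nat.
have {}qh : q%:R <= 2 * h%:R + 1 :> R by rewrite -natrM natr1 ler_nat; lia.
rewrite natrD !natrM -natr1.
have -> : 2^-1 + (16 * kappa%:R)^-1 = (8 * kappa%:R + 1) / (16 * kappa%:R) :> R.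
  by field; rewrite gt_eqF//; lra.
rewrite mulrAC ler_pdivrMr; last by lra.
move: kR bR hk qh; set k := kappa%:R; set B := b%:R; set H := h%:R; set Q := q%:R.
move=> kR bR hk qh.
suff : (8 * k + 1) * (k * Q + H) <= 16 * k * ((k + 1) * H).
  by move=> h1; have := ler_wpM2l (ltW bR) h1; lra.
have h1 : k * Q <= k * (2 * H + 1) by rewrite ler_wpM2l//; lra.
have h2 : (8 * k + 1) * (k * Q + H) <= (8 * k + 1) * (k * (2 * H + 1) + H).
  by rewrite ler_wpM2l//; lra.
apply: le_trans h2 _.
have h3 : k * (2 * k) <= k * H by rewrite ler_wpM2l//; lra.
have h4 : 1 * k <= k * k by rewrite ler_wpM2r//; lra.
have h5 : 1 * H <= k * H by rewrite ler_wpM2r//; lra.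
by lra.
Qed.

(** * Measurability of the fluctuation set *)

Section FluctSetMeasurable.
Context {d : measure_display} {X : measurableType d} {R : realType}.
Context {mu : probability X R} {T Tinv : X -> X}.
Context (hT : invertible_measure_preserving mu T Tinv).

Lemma measurable_zpow k : measurable_fun setT (zpow T Tinv k).
Proof.
by case: k => n _ A mA; rewrite setTI; [exact: measurable_preimage_iter hT _ _ mA|
  exact: measurable_preimage_iterV hT _ _ mA].
Qed.

Lemma measurable_ergodic_avg (F : nat -> {fset int}) (f : X -> R) n :
  measurable_fun setT f -> measurable_fun setT (ergodic_avg T Tinv F f n).
Proof.
move=> mf; apply: measurable_funM; first exact: measurable_cst.
apply: measurable_sum => k; exact: measurableT_comp mf (measurable_zpow k).
Qed.

(** There are uncountably many [s], but only finitely many of their values matter, so a union over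
    finite sequences, a countable type, suffices. *)
Lemma measurable_fluct_set (F : nat -> {fset int}) (f : X -> R) alpha beta N :
  measurable_fun setT f -> measurable (fluct_set T Tinv F f alpha beta N).
Proof.
move=> mf.
pose a n x := ergodic_avg T Tinv F f n x.
pose increasing (s : nat -> nat) :=
  forall i j, (1 <= i)%N -> (i < j)%N -> (j <= 2 * N)%N -> (s i < s j)%N.
pose C (t : seq nat) := if pselect (increasing (nth 0%N t)) then
  \bigcap_i (if (1 <= i <= 2 * N)%N then
      if odd i then [set x | a (nth 0%N t i) x <= alpha]
      else [set x | beta <= a (nth 0%N t i) x]
    else setT) else set0.
rewrite (_ : fluct_set _ _ _ _ _ _ _ = \bigcup_t C t); last first.
  apply/seteqP; split => [x [s [incs hs]]|x [t _]].
    have nths i : (i <= 2 * N)%N -> nth 0%N (mkseq s (2 * N).+1) i = s i.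
      by move=> iN; rewrite nth_mkseq.
    exists (mkseq s (2 * N).+1) => //; rewrite /C; case: pselect => [inct|[]];
      last first.
      by move=> i j i1 ij jN; rewrite !nths//; [exact: incs|lia].
    move=> i _; case: ifP => // /andP[i1 iN]; rewrite nths//.
    by have := hs i i1 iN; case: ifP.
  rewrite /C; case: pselect => [inct h|//]; exists (nth 0%N t); split => // i i1 iN.
  by have := h i I; rewrite i1 iN /=; case: ifP.
apply: countable_bigcupT_measurable => // t; rewrite /C;
  case: pselect => [inct|ninct]; last exact: measurable0.
apply: bigcapT_measurable => i; case: ifP => _; last exact: measurableT.
have ma n : measurable_fun setT (a n) by exact: measurable_ergodic_avg.
case: ifP => _; rewrite -[X in measurable X]setTI.
- exact: measurable_fun_le measurableT (ma _) (measurable_cst _).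
- exact: measurable_fun_le measurableT (measurable_cst _) (ma _).
Qed.

End FluctSetMeasurable.

(** * Stages *)

Section PatternSequence.
Context {d : measure_display} {X : measurableType d} {R : realType}.
Context {mu : probability X R} {T Tinv : X -> X}.
Context (hT : invertible_measure_preserving mu T Tinv).

Local Notation pr := (pr mu).
Local Notation pattern := (@pattern _ _ _ mu T).

(** [eps j] is obtained from [j] and [delta j], and [delta (j+1)] is a quarter of the smaller of
    [eps j] and [delta j]. All are fixed before any [L]. *)
Lemma exists_pattern_sequence (hZ : effective_action mu T Tinv) (p0 : nat -> nat) :
  exists (q : nat -> nat) (eps delta : nat -> R),
  [/\ forall j, (p0 j <= q j)%N, forall j, 0 < eps j,
      forall i j, delta (j.+1 + i)%N <= eps j / 2 / (2 ^ i.+1)%:R &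
      forall j L, exists S A G, pattern (delta j) (eps j) (q j) L S A G].
Proof.
have step (p : nat * R) : exists r : nat * R, 0 < p.2 ->
    [/\ (p0 p.1 <= r.1)%N, 0 < r.2 &
    forall L, exists S A G, pattern p.2 r.2 r.1 L S A G].
  case: p => j delta; have [delta0|] := boolP (0 < delta); last by exists (0%N, 0).
  have [q [eps h]] := exists_pattern hT hZ delta (p0 j) delta0.
  by exists (q, eps).
have [g gP] := choice step.
pose delta := fix delta j :=
  if j is i.+1 then Num.min (g (i, delta i)).2 (delta i) / 4 else 1.
have delta0 j : 0 < delta j.
  elim: j => // j IH; rewrite /= divr_gt0// lt_min IH andbT.
  by have [] := gP (j, delta j) IH.
have deltaS j : delta j.+1 <= (g (j, delta j)).2 / 4 /\ delta j.+1 <= delta j / 4.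
  by split; rewrite /= ler_pM2r ?invr_gt0// ge_min lexx ?orbT.
clearbody delta; exists (fun j => (g (j, delta j)).1), (fun j => (g (j, delta
  j)).2), delta.
split => [j|j|i j|j]; try by have [] := gP (j, delta j) (delta0 j).
elim: i => [|i IH]; first by rewrite addn0 expn1 /=; have [h _] := deltaS j; lra.
have h : delta (j.+1 + i.+1)%N <= delta (j.+1 + i)%N / 2.
  rewrite addnS; have [_ h] := deltaS (j.+1 + i)%N.
  by have h0 := delta0 (j.+1 + i)%N; lra.
apply: (le_trans h); rewrite (expnS 2 i.+1) natrM invfM.
by move: IH => /=; set v := (2 ^ i.+1)%:R^-1; lra.
Qed.

(** Up to time [L j], the orbit of a point of [G' j] stays in [S j], where earlier paint is erased,
    and avoids later regions, so [B] agrees with [A j] there. The points removed from [G j] have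
    measure at most [eps j / 2]. *)
Lemma glue_patterns {q L : nat -> nat} {eps delta : nat -> R}
    {S A G : nat -> set X} :
  (forall i j, delta (j.+1 + i)%N <= eps j / 2 / (2 ^ i.+1)%:R) ->
  (forall i j, (i <= j)%N -> (L i <= L j)%N) ->
  (forall j, pattern (delta j) (eps j) (q j) (L j) (S j) (A j) (G j)) ->
  exists (B : set X) (G' : nat -> set X),
  [/\ measurable B, forall j, measurable (G' j), forall j, eps j / 2 <= pr (G' j) &
      forall j x m, G' j x -> (m <= L j)%N ->
        (B (iter m T x) <-> (m %% q j < (q j)./2)%N)].
Proof.
move=> hdelta monoL hpat.
have mS j : measurable (S j) by case: (hpat j).
have mA j : measurable (A j) by case: (hpat j).
have mG j : measurable (G j) by case: (hpat j).
pose W j := \bigcup_(m < (L j).+1) iter m T @^-1` S j.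
have mW j : measurable (W j).
  by apply: measurable_bigcup_lt => m; exact: measurable_preimage_iter hT _ _ (mS j).
exists (\bigcup_j (A j `\` \bigcup_i S (j.+1 + i)%N)).
exists (fun j => G j `\` \bigcup_i W (j.+1 + i)%N).
have mWj j : measurable (\bigcup_i W (j.+1 + i)%N) by exact: bigcupT_measurable.
split.
- by apply: bigcupT_measurable => j; apply: measurableD => //;
  exact: bigcupT_measurable.
- by move=> j; exact: measurableD.
- move=> j; have [_ _ _ _ [_ epsG _]] := hpat j.
  have := le_prD (mG j) (mWj j) (mu := mu).
  have : pr (\bigcup_i W (j.+1 + i)%N) <= eps j / 2.
    apply: pr_bigcup_geometric => // i; apply: le_trans (hdelta i j).
    by have [_ _ _ _ []] := hpat (j.+1 + i)%N.
  lra.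
- move=> j x m [Gx nW] mL.
  have [_ _ _ _ [_ _ /(_ x m Gx mL)[Sm <-]]] := hpat j.
  have nS i : (j < i)%N -> ~ S i (iter m T x).
    move=> ji Si; apply: nW; exists (i - j.+1)%N => //; rewrite subnKC//.
    by exists m => //=; rewrite ltnS (leq_trans mL)// monoL// ltnW.
  split => [[i _ [Ai nSi]]|Am]; last first.
    by exists j => //; split => // -[i _]; apply: nS; lia.
  have [ij|ji|<-//] := ltngtP i j.
    by case: nSi; exists (j - i.+1)%N => //; rewrite subnKC.
  by case: (nS i ji); have [_ _ _ + _] := hpat i; apply.
Qed.

End PatternSequence.

(** Stage [j] gets [2 N j] consecutive indices, as many as [N j] fluctuations use, and starts at an
    even index. *)
Lemma exists_blocks (N : nat -> nat) : (forall j, (0 < N j)%N) ->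
  exists (K stage : nat -> nat), [/\ forall j, K j.+1 = (K j + N j)%N,
    forall i j, (i <= j)%N -> (K i <= K j)%N &
    forall n j, (2 * K j <= n < 2 * K j.+1)%N = (stage n == j)].
Proof.
move=> N0; pose K := fix K j := if j is i.+1 then (K i + N i)%N else 0%N.
have KS j : K j.+1 = (K j + N j)%N by [].
have monoK i j : (i <= j)%N -> (K i <= K j)%N.
  move=> /subnK <-; elim: (j - i)%N => // k IH.
  by rewrite addSn KS (leq_trans IH)// leq_addr.
have gek j : (j <= K j)%N by elim: j => // j IH; rewrite KS; have := N0 j; lia.
have step n : exists j, (2 * K j <= n < 2 * K j.+1)%N.
  have exj : exists j, (n < 2 * K j.+1)%N.
    by exists n; have := gek n.+1; lia.
  case: (ex_minnP exj) => j nj jmin; exists j; rewrite nj andbT leqNgt.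
  by apply/negP; case: j nj jmin => [_ _|j _ jmin /jmin]; rewrite ?ltnn//= muln0.
have [stage stageP] := choice step.
exists K, stage; split => // n j; apply/idP/eqP => [/andP[jn nj]|<-//].
have /andP[sn ns] := stageP n.
have [h|h|//] := ltngtP (stage n) j; have := monoK _ _ h; lia.
Qed.

Theorem theorem1p4 (R : realType) (d : measure_display) (X : measurableType d)
    (mu : probability X R) (T Tinv : X -> X)
    (hT : invertible_measure_preserving mu T Tinv)
    (hZ : effective_action mu T Tinv)
    (omega : nat -> R)
    (omega_decr : nonincreasing_seq omega)
    (omega_lim : omega n @[n --> \oo] --> (0 : R))
    (lambda : R) (lambda_gt0 : 0 < lambda) :
  exists (alpha beta : R) (f : X -> R) (F : nat -> {fset int}),
    [/\ alpha < beta,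
        measurable_fun setT f,
        (forall x, 0 <= f x <= 1),
        folner R F /\ tempered (1 + lambda) F &
        \forall N \near \oo,
          ((omega N)%:E < mu (fluct_set T Tinv F f alpha beta N))%E].
Proof.
have [kappa [k0 lk]] : exists kappa, (0 < kappa)%N /\ 2 <= lambda * kappa%:R.
  exists (Num.bound (2 / lambda)).+1; split => //.
  rewrite mulrC -ler_pdivrMr// -natr1.
  have : 2 / lambda < (Num.bound (2 / lambda))%:R.
    by apply: archi_boundP; rewrite divr_ge0// ltW.
  lra.
(* The bound [j] serves the Foelner property, and [4 kappa + 2] the gap. *)
have [q [eps [delta [qge eps0 hdelta hpat]]]] :=
  exists_pattern_sequence hT hZ (fun j => maxn j (4 * kappa + 2)).
(* The condition [j < n] makes the [N j] positive and unbounded. *)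
have stepN j : exists n, omega n < eps j.+1 / 2 /\ (j < n)%N.
  have e0 : 0 < eps j.+1 / 2 by rewrite divr_gt0.
  move/cvgrPdist_lt: omega_lim => /(_ _ e0)[n _ hn].
  exists (maxn n j.+1); split; last by rewrite leq_maxr.
  have := hn (maxn n j.+1) (leq_maxl _ _).
  by rewrite sub0r normrN; apply: le_lt_trans; exact: ler_norm.
have [N hN] := choice stepN.
have [|K [stage [KS monoK hstage]]] := exists_blocks N.
  by move=> j; case: (hN j) => _; lia.
(* [b (m+1)] is the length of the window of comb [m], which gives the growth needed by
   [comb_tempered]. Even indices have teeth off the counted residues, odd ones on them. *)
pose b := fix b n := if n is m.+1 then (kappa.+1 * b m * q (stage m))%N else 1%N.
pose c n := if odd n then 0%N else (q (stage n))./2.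
have q0 j : (0 < q j)%N by have := qge j; lia.
have b0 n : (0 < b n)%N by elim: n => //= n IH; rewrite !muln_gt0 IH q0.
have monob m n : (m <= n)%N -> (b m <= b n)%N.
  move=> /subnK <-; elim: (n - m)%N => // l IH; apply: (leq_trans IH).
  by rewrite addSn /= mulnC mulnA leq_pmull// muln_gt0 q0.
have cq n : (c n + (q (stage n))./2 <= q (stage n))%N by rewrite /c; case: ifP; lia.
(* This is the window length of the last comb of stage [j]. *)
pose L j := b (2 * K j.+1)%N.
have monoL i j : (i <= j)%N -> (L i <= L j)%N.
  by move=> ij; apply: monob; rewrite leq_mul2l monoK.
have [P hP] := choice (fun j => hpat j (L j)).
have [A hA] := choice hP; have [G hG] := choice hA.
have [B [G' [mB mG' epsG' hB]]] := glue_patterns hT hdelta monoL hG.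
pose f : X -> R := \1_B.
pose F n := natset (comb kappa (q (stage n)) (b n) (c n)).
exists 2^-1, (2^-1 + (16 * kappa%:R)^-1), f, F.
have mf : measurable_fun setT f by exact: measurable_indic.
have G'fluct j n : (n <= N j)%N ->
    G' j `<=` fluct_set T Tinv F f 2^-1 (2^-1 + (16 * kappa%:R)^-1) n.
  (* The predecessor sends [i = 1] to the even index [2 K j], so odd [i] fall on low averages. *)
  move=> nN x G'x; exists (fun i => (2 * K j + i).-1); split => [i l|i i1 iN].
    by lia.
  set t := (2 * K j + i).-1.
  have st : stage t = j by apply/eqP; rewrite -hstage KS /t; lia.
  have oddt : odd t = ~~ odd i.
    have -> : t = (2 * K j + i.-1)%N by rewrite /t; lia.
    by rewrite oddD oddM /=; case: i i1 {iN t st} => // i _ /=; rewrite negbK.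
  have ft m : (m < kappa.+1 * b t * q (stage t))%N ->
      f (iter m T x) = (m %% q (stage t) < (q (stage t))./2)%N%:R.
    move=> mt; rewrite /f indicE; congr ((nat_of_bool _)%:R).
    have mL : (m <= L j)%N.
      apply/ltnW/(leq_trans mt)/(monob t.+1); rewrite /t KS; lia.
    by rewrite st; apply/idP/idP; rewrite inE => /(hB j x m G'x mL).
  rewrite (comb_avg kappa (fun n => q (stage n)) b c)// st.
  rewrite /c oddt; case: (odd i) => /=.
    by rewrite st count_comb_low low_ratio_le.
  rewrite count_comb_high high_ratio_ge//.
  by have := qge j; lia.
split => //.
- by rewrite ltrDl invr_gt0 mulr_gt0// ltr0n.
- by move=> x; rewrite /f indicE; case: (_ \in _); rewrite ?lexx ?ler01.
- split.
  + apply: comb_folner => // j; exists (2 * K j)%N => n jn.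
    have : (2 * K (stage n) <= n < 2 * K (stage n).+1)%N by rewrite hstage.
    have [h|h] := leqP j (stage n); first by have := qge (stage n); lia.
    by have := monoK _ _ h; lia.
  + apply: comb_tempered => // i n /monob /= h.
    by apply: (leq_trans h); rewrite leq_pmulr.
exists (N 0%N).+1 => // n /= n0.
have exj : exists j, (n <= N j)%N by exists n; case: (hN n) => _ /ltnW.
(* Minimality gives [N j <= n] even if [N] is not monotone. Hence
   [omega n <= omega (N j) < eps (j+1) / 2], while stage [j+1] is long enough for [n]
   fluctuations. *)
case: (ex_minnP exj) => -[|j] nj jmin; first by lia.
have Njn : (N j <= n)%N.
  by rewrite leqNgt; apply/negP => /ltnW /jmin; rewrite ltnn.
have mD : measurable (fluct_set T Tinv F f 2^-1 (2^-1 + (16 * kappa%:R)^-1) n).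
  exact: measurable_fluct_set hT _ _ _ _ _ mf.
rewrite (prE mD).
rewrite lte_fin; apply: le_lt_trans (omega_decr _ _ Njn) _.
apply: lt_le_trans (proj1 (hN j)) _; apply: le_trans (epsG' j.+1) _.
exact: le_pr (mG' _) mD (G'fluct _ _ nj).
Qed.
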